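(* Let $r,s$ and $p$ be arbitrary integers with $r\neq 0$, and let $m$ be any real number. Then for every non-negative integer $n$, \[ \sum_{k = 0}^n (-1)^{(s+1)k} \binom {n}{k} \binom {m + n - k}{n} \Big (\frac{F_{r+s}}{F_r}\Big )^k F_{sk+p} = \sum_{k = 0}^n (-1)^{(s+1)k} \binom {n}{k} \binom {m}{k} \Big (\frac{F_{s}}{F_r}\Big )^k F_{(r+s)k+p}, \] \[ \sum_{k = 0}^n (-1)^{(s+1)k} \binom {n}{k} \binom {m + n - k}{n} \Big (\frac{F_{r+s}}{F_r}\Big )^k L_{sk+p} = \sum_{k = 0}^n (-1)^{(s+1)k} \binom {n}{k} \binom {m}{k} \Big (\frac{F_{s}}{F_r}\Big )^k L_{(r+s)k+p}. \] In particular, \[ \sum_{k = 0}^n (-1)^{(s+1)k} \frac{ \binom {n}{k} \binom {2(2n - k)}{2n - k} \binom {2n - k}{n}}{\binom {2(n - k)}{n - k}} \Big (\frac{F_{r+s}}{F_r}\Big )^k F_{sk+p} = \binom {2n}{n} \sum_{k = 0}^n (-1)^{(s+1)k} \frac{\binom {n}{k}^2}{\binom {2(n - k)}{n - k}} 2^{2(n-k)}\Big (\frac{F_{s}}{F_r}\Big )^k F_{(r+s)k+p}, \] \[ \sum_{k = 0}^n (-1)^{(s+1)k} \frac{ \binom {n}{k} \binom {2(2n - k)}{2n - k} \binom {2n - k}{n}}{\binom {2(n - k)}{n - k}} \Big (\frac{F_{r+s}}{F_r}\Big )^k L_{sk+p} = \binom {2n}{n} \sum_{k = 0}^n (-1)^{(s+1)k}\frac{\binom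 {n}{k}^2}{\binom {2(n - k)}{n - k}}2^{2(n-k)} \Big (\frac{F_{s}}{F_r}\Big )^k L_{(r+s)k+p}. \]
   Context: $F_j$ and $L_j$ denote the Fibonacci and Lucas numbers: $F_0=0,F_1=1$, $L_0=2,L_1=1$, both satisfying $X_j=X_{j-1}+X_{j-2}$, extended to all integer indices via the recurrence (so $F_{-j}=(-1)^{j+1}F_j$, $L_{-j}=(-1)^jL_j$). For a real number $x$ and a non-negative integer $k$, $\binom{x}{k}=x(x-1)\cdots(x-k+1)/k!$. *)

(* Defs.v *)
From mathcomp Require Import all_boot all_order all_algebra.
From mathcomp Require Import reals.

Set Implicit Arguments.
Unset Strict Implicit.
Unset Printing Implicit Defensive.

Import Order.TTheory GRing.Theory Num.Theory.
Local Open Scope ring_scope.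

Definition fib_next (u : int * int) : int * int := (u.2, u.1 + u.2).
Definition fib_prev (u : int * int) : int * int := (u.2 - u.1, u.1).

(* The sequence X indexed by all integers with X 0 = a, X 1 = b and
   X j = X (j - 1) + X (j - 2): the pair (X j, X (j + 1)) is shifted forwards
   or backwards by the recurrence.  Recall that Negz k is - (k + 1). *)
Definition gibonacci (a b : int) (j : int) : int :=
  match j with
  | Posz k => (iter k fib_next (a, b)).1
  | Negz k => (iter k.+1 fib_prev (a, b)).1
  end.

Definition fib (j : int) : int := gibonacci 0 1 j.
Definition lucas (j : int) : int := gibonacci 2 1 j.

Definition gbinom (R : realType) (x : R) (k : nat) : R :=
  (\prod_(i < k) (x - i%:R)) / (k`!)%:R.

Lemma gibonacci_rec a b (j : int) :
  gibonacci a b j = gibonacci a b (j - 1) + gibonacci a b (j - 2).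
Proof.
case: j => [[|[|k]]|k].
- rewrite (_ : 0%:Z - 1 = Negz 0) // (_ : 0%:Z - 2 = Negz 1) //=.
  by rewrite addrC subrK.
- rewrite (_ : 1%:Z - 1 = 0%:Z) // (_ : 1%:Z - 2 = Negz 0) //=.
  by rewrite addrC subrK.
- have -> : k.+2%:Z - 1 = k.+1%:Z by rewrite intS addrC addKr.
  have -> : k.+2%:Z - 2 = k%:Z by rewrite -[k.+2]addn2 PoszD addrK.
  by rewrite /= addrC.
- have -> : Negz k - 1 = Negz k.+1.
    by rewrite !NegzE -opprD -PoszD addn1.
  have -> : Negz k - 2 = Negz k.+2.
    by rewrite !NegzE -opprD -PoszD addn2.
  by rewrite /= [RHS]addrC subrK.
Qed.

Lemma fib0 : fib 0 = 0. Proof. by []. Qed.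
Lemma fib1 : fib 1 = 1. Proof. by []. Qed.
Lemma lucas0 : lucas 0 = 2. Proof. by []. Qed.
Lemma lucas1 : lucas 1 = 1. Proof. by []. Qed.

Lemma fib_rec (j : int) : fib j = fib (j - 1) + fib (j - 2).
Proof. exact: gibonacci_rec. Qed.

Lemma lucas_rec (j : int) : lucas j = lucas (j - 1) + lucas (j - 2).
Proof. exact: gibonacci_rec. Qed.

(* Main.v *)
(* Each fib and lucas is a combination A alpha^j + B beta^j of powers of the
   roots of x^2 = x + 1.  For u one of the roots, put
   y = (-1)^s (fib s / fib r) u^(r+s); then
   1 + y = (-1)^s (fib (r+s) / fib r) u^s, and the first two identities become
     sum_k C(n,k) C(m+n-k,n) (-(1+y))^k = sum_k C(n,k) C(m,k) (-y)^k,
   that is, (E - (1+y))^n = (D - y)^n for the shift E = 1 + D acting on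
   m |-> C(m,n).  The last two are the case m = n - 1/2, multiplied by 4^n. *)

Require Import Defs.
From mathcomp Require Import all_boot all_order all_algebra.
From mathcomp Require Import reals.
From mathcomp Require Import ring lra zify.

Set Implicit Arguments.
Unset Strict Implicit.
Unset Printing Implicit Defensive.

Import Order.TTheory GRing.Theory Num.Theory.
Local Open Scope ring_scope.

(** * Generalized binomial coefficients and the shift identity *)

Section Binomial.

Variable R : realType.

Lemma gbinomS (x : R) (k : nat) :
  gbinom x k.+1 = gbinom x k * (x - k%:R) / k.+1%:R.
Proof. by rewrite /gbinom big_ord_recr /= factS natrM invfM; ring. Qed.

Lemma gbinom_pascal (x : R) (k : nat) :
  gbinom (x + 1) k.+1 = gbinom x k.+1 + gbinom x k.
Proof.
elim: k => [|k IHk].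
  by rewrite !gbinomS /gbinom !big_ord0 fact0; field.
rewrite gbinomS IHk [gbinom x k.+2]gbinomS [gbinom x k.+1]gbinomS -!natr1.
by field; rewrite !natr1 !pnatr_eq0.
Qed.

Lemma sum_pascal (f : nat -> R) (n : nat) :
  \sum_(k < n.+2) ('C(n.+1, k))%:R * f k =
  \sum_(k < n.+1) ('C(n, k))%:R * f k + \sum_(k < n.+1) ('C(n, k))%:R * f k.+1.
Proof.
rewrite big_ord_recl /= bin0.
under eq_bigr => i _ do rewrite /bump /= add1n binS natrD mulrDl.
rewrite big_split /= addrA; congr (_ + _).
(* The top term carries ['C(n, n.+1)], which is 0; the term at k = 0 split off above restores the
   full first sum. *)
by rewrite big_ord_recr /= bin_small // mul0r addr0 [RHS]big_ord_recl /= bin0.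
Qed.

(* The offset c makes the induction on n go through: the step raises it. *)
Lemma sum_gbinom_shift (y z : R) (n c : nat) :
  \sum_(k < n.+1)
     ('C(n, k))%:R * ((- (1 + y)) ^+ k * gbinom (z + n%:R - k%:R) (n + c)) =
  \sum_(k < n.+1) ('C(n, k))%:R * ((- y) ^+ k * gbinom z (k + c)).
Proof.
elim: n c z => [|n IHn] c z.
  by rewrite !big_ord1 /= !bin0 addr0 subr0.
rewrite (sum_pascal (fun k => (- (1 + y)) ^+ k *
  gbinom (z + n.+1%:R - k%:R) (n.+1 + c))).
rewrite (sum_pascal (fun k => (- y) ^+ k * gbinom z (k + c))).
(* The induction hypothesis is used at offset [c.+1] twice: at [z + 1] for this half, and at [z] for
   the next one, where the index [k.+1] cancels the extra 1. *)
have -> : \sum_(k < n.+1) ('C(n, k))%:R *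
    ((- (1 + y)) ^+ k * gbinom (z + n.+1%:R - k%:R) (n.+1 + c)) =
    \sum_(k < n.+1) ('C(n, k))%:R * ((- y) ^+ k * gbinom (z + 1) (k + c.+1)).
  rewrite -IHn; apply: eq_bigr => k _; rewrite addSnnS.
  by congr (_ * (_ * gbinom _ _)); rewrite -natr1; ring.
have -> : \sum_(k < n.+1) ('C(n, k))%:R *
    ((- (1 + y)) ^+ k.+1 * gbinom (z + n.+1%:R - k.+1%:R) (n.+1 + c)) =
    - (1 + y) *
    \sum_(k < n.+1) ('C(n, k))%:R * ((- y) ^+ k * gbinom z (k + c.+1)).
  rewrite -IHn mulr_sumr; apply: eq_bigr => k _; rewrite addSnnS.
  have -> : z + n.+1%:R - k.+1%:R = z + n%:R - k%:R :> R.
    by rewrite -!natr1; ring.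
  by rewrite exprS; ring.
(* Termwise this is E - (1 + y) = D - y: by Pascal's rule, going from [z] to [z + 1] adds exactly
   the coefficient of one lower order. *)
rewrite mulr_sumr -!big_split /=; apply: eq_bigr => k _.
by rewrite addnS gbinom_pascal addSn exprS; ring.
Qed.

Lemma bin_natr_neq0 (n k : nat) : (k <= n)%N -> ('C(n, k))%:R != 0 :> R.
Proof. by move=> le_kn; rewrite pnatr_eq0 -lt0n bin_gt0. Qed.

Lemma central_binS (j : nat) :
  ('C(2 * j.+1, j.+1))%:R * j.+1%:R =
  2 * (2 * j%:R + 1) * ('C(2 * j, j))%:R :> R.
Proof.
have e1 : (j.+1 * 'C(2 * j.+1, j.+1) = 2 * j.+1 * 'C((2 * j).+1, j))%N.
  by rewrite [(2 * j.+1)%N]mulnS add2n -mul_bin_diag.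
have e2 : (j.+1 * 'C((2 * j).+1, j) = (2 * j).+1 * 'C(2 * j, j))%N.
  have := mul_bin_left (2 * j).+1 j.
  rewrite (_ : ((2 * j).+1 - j = j.+1)%N); last by lia.
  by move=> <-; rewrite -mul_bin_diag.
have e : ('C(2 * j.+1, j.+1) * j.+1 = 2 * (2 * j).+1 * 'C(2 * j, j))%N by nia.
by rewrite -natrM e !natrM -[(2 * j).+1%:R]natr1 natrM.
Qed.

(** With j = N - k - 1, passing from k to k + 1 multiplies the left side by (j + 1/2) / (k + 1). On
    the right, 'C(N, k) contributes (j + 1) / (k + 1), the power of 2 contributes 1/4, and the
    central binomial contributes 2(2j + 1) / (j + 1) by [central_binS]. *)
Lemma gbinom_half (N k : nat) : (k <= N)%N ->
  gbinom (N%:R - 2^-1 : R) k =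
  ('C(2 * N, N))%:R * ('C(N, k))%:R
    / (2 ^+ (2 * k) * ('C(2 * (N - k), N - k))%:R).
Proof.
elim: k => [_|k IHk ltkN].
  rewrite /gbinom big_ord0 fact0 bin0 subn0 muln0 expr0 !mul1r !mulr1 invr1.
  by rewrite divff // bin_natr_neq0 // leq_pmull.
rewrite gbinomS (IHk (ltnW ltkN)).
set j := (N - k.+1)%N.
have ej : (N - k = j.+1)%N by rewrite /j; lia.
have eN : N%:R = j%:R + k%:R + 1 :> R.
  by rewrite -natrD natr1 /j; congr (_%:R); lia.
have hk : k.+1%:R * ('C(N, k.+1))%:R = j.+1%:R * ('C(N, k))%:R :> R.
  by rewrite -!natrM mul_bin_left ej.
have hj := central_binS j.
have c0 : ('C(2 * j, j))%:R != 0 :> R by rewrite bin_natr_neq0 // leq_pmull.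
have c1 : ('C(2 * j.+1, j.+1))%:R != 0 :> R.
  by rewrite bin_natr_neq0 // leq_pmull.
have k0 : k.+1%:R != 0 :> R by rewrite pnatr_eq0.
have j0 : j.+1%:R != 0 :> R by rewrite pnatr_eq0.
have t0 : 2 ^+ (2 * k) != 0 :> R by rewrite expf_neq0 // pnatr_eq0.
have -> : ('C(N, k.+1))%:R = j.+1%:R * ('C(N, k))%:R / k.+1%:R :> R.
  by rewrite -hk mulrC mulKf.
rewrite ej.
have -> : ('C(2 * j.+1, j.+1))%:R =
    2 * (2 * j%:R + 1) * ('C(2 * j, j))%:R / j.+1%:R :> R.
  by rewrite -hj mulfK.
have d0 : 2 * j%:R + 1 != 0 :> R by rewrite -natrM natr1 pnatr_eq0.
rewrite mulnS exprD {}eN.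
move: k0 j0; rewrite -[k.+1%:R]natr1 -[j.+1%:R]natr1 => k0 j0.
by field; rewrite k0 j0 c0 d0 t0.
Qed.

End Binomial.

(** * Binet formulas over all integer indices and the sums for one root *)

Section Binet.

Variable R : realType.

Lemma golden_roots : exists alpha beta : R,
  [/\ alpha + beta = 1, alpha * beta = -1 & 1 < alpha].
Proof.
have h : Num.sqrt 5 * Num.sqrt 5 = 5 :> R by rewrite -expr2 sqr_sqrtr ?ler0n.
have h0 : 0 <= Num.sqrt 5 :> R := sqrtr_ge0 _.
exists ((1 + Num.sqrt 5) / 2), ((1 - Num.sqrt 5) / 2).
split; [by field | | nra].
transitivity ((1 - Num.sqrt 5 * Num.sqrt 5) / 4 : R); first by field.
by rewrite h; field.
Qed.

Variables alpha beta : R.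
Hypothesis alphaD : alpha + beta = 1.
Hypothesis alphaM : alpha * beta = -1.
Hypothesis alpha_gt1 : 1 < alpha.

Let alpha_neq0 : alpha != 0.
Proof. by rewrite gt_eqF // (lt_trans ltr01). Qed.

Let betaE : beta = - alpha^-1.
Proof. by apply: (mulfI alpha_neq0); rewrite alphaM mulrN divff. Qed.

Let beta_neq0 : beta != 0.
Proof. by rewrite betaE oppr_eq0 invr_eq0. Qed.

Let alphaB_neq0 : alpha - beta != 0.
Proof.
rewrite betaE opprK gt_eqF // addr_gt0 ?invr_gt0 //;
  exact: lt_trans ltr01 alpha_gt1.
Qed.

Let alpha_sq : alpha * alpha = alpha + 1.
Proof.
have -> : alpha * alpha = alpha * (alpha + beta) - alpha * beta by ring.
by rewrite alphaD alphaM mulr1 opprK.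
Qed.

Let beta_sq : beta * beta = beta + 1.
Proof.
have -> : beta * beta = beta * (alpha + beta) - alpha * beta by ring.
by rewrite alphaD alphaM mulr1 opprK.
Qed.

(** [A] and [B] solve the linear system given by the values at 0 and 1; the formula then spreads in
    both directions, forwards by u^2 = u + 1 and backwards by u - 1 = u^-1. *)
Lemma gibonacci_binet (a b : int) : exists A B : R, forall j : int,
  (gibonacci a b j)%:~R = A * alpha ^ j + B * beta ^ j.
Proof.
pose A := (b%:~R - a%:~R * beta) / (alpha - beta).
pose B := (a%:~R * alpha - b%:~R) / (alpha - beta).
have e0 : A + B = a%:~R by rewrite /A /B; field.
have e1 : A * alpha + B * beta = b%:~R by rewrite /A /B; field.
clearbody A B; exists A, B.
have pow2 (u : R) k : u * u = u + 1 -> u ^+ k.+2 = u ^+ k.+1 + u ^+ k.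
  by move=> hu; rewrite !exprSr -mulrA hu; ring.
have up k : (iter k fib_next (a, b)).1%:~R = A * alpha ^+ k + B * beta ^+ k /\
    (iter k fib_next (a, b)).2%:~R = A * alpha ^+ k.+1 + B * beta ^+ k.+1.
  elim: k => [|k [IH1 IH2]].
    by rewrite /= !expr0 !expr1 !mulr1 e0 e1.
  split; first exact: IH2.
  rewrite iterS /= rmorphD /= IH1 IH2 (pow2 _ _ alpha_sq) (pow2 _ _ beta_sq).
  by ring.
have down k :
    (iter k fib_prev (a, b)).1%:~R = A * alpha ^- k + B * beta ^- k /\
    (iter k fib_prev (a, b)).2%:~R =
      A * alpha ^- k * alpha + B * beta ^- k * beta.
  elim: k => [|k [IH1 IH2]].
    by rewrite /= !expr0 !invr1 !mulr1 e0 e1.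
  rewrite iterS /= rmorphB /= IH1 IH2 !exprSr !invfM.
  have ea : alpha - 1 = alpha^-1.
    by apply: (mulfI alpha_neq0); rewrite mulrBr alpha_sq divff //; ring.
  have eb : beta - 1 = beta^-1.
    by apply: (mulfI beta_neq0); rewrite mulrBr beta_sq divff //; ring.
  split; last by field; rewrite alpha_neq0 beta_neq0 !expf_neq0.
  by rewrite -ea -eb; ring.
by case=> k; [exact: (up k).1 | exact: (down k.+1).1].
Qed.

Lemma fib_binet (j : int) :
  (fib j)%:~R = (alpha ^ j - beta ^ j) / (alpha - beta).
Proof.
have [A [B h]] := gibonacci_binet 0 1.
have h0 : A + B = 0 by have := h 0; rewrite !expr0z !mulr1 => <-.
have h1 : A * alpha + B * beta = 1 by have := h 1; rewrite !expr1z => <-.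
have eB : B = - A by rewrite -[LHS](addKr A) h0 addr0.
have eA : A = (alpha - beta)^-1.
  apply: (mulIf alphaB_neq0); rewrite mulVf // -h1 eB.
  by ring.
by rewrite /fib h eB eA; ring.
Qed.

(** A zero would force alpha^r = beta^r. For r > 0 this is impossible, since |beta| = 1/alpha makes
    one side larger than 1 and the other smaller in absolute value; negative r follows by taking
    inverses. *)
Lemma fib_neq0 (r : int) : r != 0 -> (fib r)%:~R != 0 :> R.
Proof.
have pow k : alpha ^+ k.+1 != beta ^+ k.+1.
  have a1 : 1 < alpha ^+ k.+1 by rewrite exprn_egt1.
  apply/eqP => e.
  have : `|beta ^+ k.+1| = (alpha ^+ k.+1)^-1.
    rewrite betaE normrX normrN normfV gtr0_norm ?exprVn //.
    exact: lt_trans alpha_gt1.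
  rewrite -e gtr0_norm; last exact: lt_trans a1.
  by move=> e'; have := invf_lt1 (lt_trans ltr01 a1); rewrite a1 -e' ltNge ltW.
rewrite fib_binet => r0; rewrite mulf_neq0 ?invr_neq0 // subr_eq0.
case: r r0 => [[|k]|k] // _; first exact: pow.
by apply: contra (pow k) => /eqP/invr_inj ->.
Qed.

Let sign_exp (s : int) : (-1) ^ s = alpha ^ s * beta ^ s.
Proof. by rewrite -exprMz_comm ?alphaM ?unitfE //; exact: mulrC. Qed.

Let sign_sq (s : int) : ((-1) ^ s) * ((-1) ^ s) = 1 :> R.
Proof. by rewrite -exprMz_comm ?mulrNN ?mulr1 ?exp1rz ?unitrN1. Qed.

Lemma fib_root_shift (r s : int) (u : R) : r != 0 ->
  u = alpha \/ u = beta ->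
  (-1) ^ s * ((fib (r + s))%:~R / (fib r)%:~R * u ^ s) =
  1 + (-1) ^ s * ((fib s)%:~R / (fib r)%:~R * u ^ (r + s)).
Proof.
move=> r0 hu; have := fib_neq0 r0; have e2 := sign_sq s.
have eF : (fib (r + s))%:~R * u ^ s * (-1) ^ s =
    (fib r)%:~R + (-1) ^ s * (fib s)%:~R * u ^ (r + s).
  have eu : u ^ (r + s) = u ^ r * u ^ s by rewrite expfzDr //; case: hu => ->.
  rewrite eu !fib_binet !expfzDr //.
  rewrite !sign_exp in e2 *.
  set X := alpha ^ s in e2 *; set Y := beta ^ s in e2 *.
  set U := alpha ^ r; set V := beta ^ r.
  apply/eqP; rewrite -subr_eq0; apply/eqP.
  (* For either root, the difference of the two sides factors this way, and it vanishes because X Y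
     = (-1)^s squares to 1. *)
  transitivity ((U - V) / (alpha - beta) * (X * Y * (X * Y) - 1)).
    by case: hu => ->; rewrite -/X -/Y -/U -/V; field.
  by rewrite e2 subrr mulr0.
move: eF; move: (fib r)%:~R (fib s)%:~R (fib (r + s))%:~R ((-1) ^ s) (u ^ s).
move: (u ^ (r + s)) => w f g h e v eF f0.
rewrite (_ : e * (h / f * v) = h * v * e / f); first by rewrite eF; field.
by field.
Qed.

(** This is the shift identity at offset 0 with y = (-1)^s d u^t, multiplied by u^q. The hypothesis
    rewrites 1 + y, and the minus signs of -y and -(1 + y) turn (-1)^s into (-1)^(s+1). *)
Lemma sum_gbinom_geometric (s t q : int) (c d u m : R) (n : nat) : u != 0 ->
  (-1) ^ s * (c * u ^ s) = 1 + (-1) ^ s * (d * u ^ t) ->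
  \sum_(k < n.+1)
    (-1) ^ ((s + 1) * k%:Z) * ('C(n, k))%:R * gbinom (m + n%:R - k%:R) n
    * c ^+ k * u ^ (s * k%:Z + q) =
  \sum_(k < n.+1)
    (-1) ^ ((s + 1) * k%:Z) * ('C(n, k))%:R * gbinom m k
    * d ^+ k * u ^ (t * k%:Z + q).
Proof.
move=> u0 hcd.
have := sum_gbinom_shift ((-1) ^ s * (d * u ^ t)) m n 0.
rewrite -hcd => /(congr1 ( *%R^~ (u ^ q))); rewrite !mulr_suml.
have sgn (x : R) (k : nat) : (- ((-1) ^ s * x)) ^+ k =
    (-1) ^ ((s + 1) * k%:Z) * x ^+ k.
  rewrite -exprz_exp -exprnP -exprMn; congr (_ ^+ _).
  by rewrite expfzDr ?oppr_eq0 ?oner_eq0 // expr1z; ring.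
have upow (v : int) (k : nat) : u ^ (v * k%:Z + q) = (u ^ v) ^+ k * u ^ q.
  by rewrite expfzDr // -exprz_exp.
move=> e; transitivity (\sum_(k < n.+1) ('C(n, k))%:R *
    ((- ((-1) ^ s * (c * u ^ s))) ^+ k * gbinom (m + n%:R - k%:R) (n + 0)) *
    u ^ q).
  apply: eq_bigr => k _; rewrite sgn addn0 upow exprMn; ring.
by rewrite e; apply: eq_bigr => k _; rewrite sgn addn0 upow exprMn; ring.
Qed.

End Binet.

(** * The sums for arbitrary initial values *)

Section GibonacciSums.

Variable R : realType.

(** Both sides are linear in the sequence, so the Binet form reduces the claim to one geometric
    identity per root. Keeping [a] and [b] free covers Fibonacci and Lucas numbers at once. *)
Lemma gibonacci_gbinom_sum (a b r s p : int) (m : R) (n : nat) : r != 0 ->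
  \sum_(k < n.+1)
    (-1) ^ ((s + 1) * k%:Z) * ('C(n, k))%:R * gbinom (m + n%:R - k%:R) n
    * ((fib (r + s))%:~R / (fib r)%:~R) ^+ k
    * (gibonacci a b (s * k%:Z + p))%:~R =
  \sum_(k < n.+1)
    (-1) ^ ((s + 1) * k%:Z) * ('C(n, k))%:R * gbinom m k
    * ((fib s)%:~R / (fib r)%:~R) ^+ k
    * (gibonacci a b ((r + s) * k%:Z + p))%:~R.
Proof.
move=> r0; have [x [y [xD xM x_gt1]]] := golden_roots R.
have [A [B h]] := gibonacci_binet xD xM x_gt1 a b.
have lin (F : 'I_n.+1 -> R) (E : 'I_n.+1 -> int) :
    \sum_k F k * (gibonacci a b (E k))%:~R =
    A * (\sum_k F k * x ^ E k) + B * (\sum_k F k * y ^ E k).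
  rewrite !mulr_sumr -big_split; apply: eq_bigr => k _ /=.
  by rewrite h mulrDr !(mulrCA (F k)).
rewrite !lin.
have x0 : x != 0 by rewrite gt_eqF // (lt_trans ltr01).
have y0 : y != 0 by apply: contraTneq x_gt1 => y0; move: xM; rewrite y0; lra.
rewrite (sum_gbinom_geometric _ _ _ x0
  (fib_root_shift xD xM x_gt1 s r0 (or_introl erefl))).
by rewrite (sum_gbinom_geometric _ _ _ y0
  (fib_root_shift xD xM x_gt1 s r0 (or_intror erefl))).
Qed.

Lemma gibonacci_bin_sum (a b r s p : int) (n : nat) : r != 0 ->
  \sum_(k < n.+1)
    (-1) ^ ((s + 1) * k%:Z)
    * (('C(n, k))%:R * ('C(2 * (2 * n - k), 2 * n - k))%:R
         * ('C(2 * n - k, n))%:R / ('C(2 * (n - k), n - k))%:R)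
    * ((fib (r + s))%:~R / (fib r)%:~R) ^+ k
    * (gibonacci a b (s * k%:Z + p))%:~R =
  ('C(2 * n, n))%:R * (\sum_(k < n.+1)
    (-1) ^ ((s + 1) * k%:Z)
    * (('C(n, k))%:R ^+ 2 / ('C(2 * (n - k), n - k))%:R)
    * 2 ^+ (2 * (n - k))
    * ((fib s)%:~R / (fib r)%:~R) ^+ k
    * (gibonacci a b ((r + s) * k%:Z + p))%:~R) :> R.
Proof.
move=> r0.
have t0 k : 2 ^+ k != 0 :> R by rewrite expf_neq0 // pnatr_eq0.
(* The factor 4^n clears the power of 2 that [gbinom_half] puts in every denominator on the left,
   where it applies with N = 2n - k at order n. *)
have := congr1 ( *%R (2 ^+ (2 * n)))
  (gibonacci_gbinom_sum a b s p (n%:R - 2^-1) n r0).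
rewrite !mulr_sumr => e.
apply: etrans (etrans e _); apply: eq_bigr => k _;
  have lekn := leq_ord k;
  have c0 : ('C(2 * (n - k), n - k))%:R != 0 :> R
    by [rewrite bin_natr_neq0 // leq_pmull].
  have -> : n%:R - 2^-1 + n%:R - k%:R = (2 * n - k)%:R - 2^-1 :> R.
    by rewrite natrB ?natrM; [ring | lia].
  rewrite gbinom_half; last by lia.
  have -> : (2 * n - k - n = n - k)%N by lia.
  by field; rewrite t0 c0.
rewrite gbinom_half //.
(* On the right the order is k, so only 4^k cancels and 4^(n-k) remains. *)
have -> : 2 ^+ (2 * n) = 2 ^+ (2 * (n - k)) * 2 ^+ (2 * k) :> R.
  by rewrite -exprD; congr (_ ^+ _); lia.
by field; rewrite t0 c0.
Qed.

End GibonacciSums.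

Theorem theorem43 (R : realType) (r s p : int) (hr : r != 0) :
  (forall (m : R) (n : nat),
    \sum_(k < n.+1)
        (-1) ^ ((s + 1) * k%:Z) * ('C(n, k))%:R * gbinom (m + n%:R - k%:R) n
        * ((fib (r + s))%:~R / (fib r)%:~R) ^+ k * (fib (s * k%:Z + p))%:~R
    = \sum_(k < n.+1)
        (-1) ^ ((s + 1) * k%:Z) * ('C(n, k))%:R * gbinom m k
        * ((fib s)%:~R / (fib r)%:~R) ^+ k * (fib ((r + s) * k%:Z + p))%:~R
    /\
    \sum_(k < n.+1)
        (-1) ^ ((s + 1) * k%:Z) * ('C(n, k))%:R * gbinom (m + n%:R - k%:R) n
        * ((fib (r + s))%:~R / (fib r)%:~R) ^+ k * (lucas (s * k%:Z + p))%:~R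
    = \sum_(k < n.+1)
        (-1) ^ ((s + 1) * k%:Z) * ('C(n, k))%:R * gbinom m k
        * ((fib s)%:~R / (fib r)%:~R) ^+ k * (lucas ((r + s) * k%:Z + p))%:~R)
  /\
  (forall n : nat,
    \sum_(k < n.+1)
        (-1) ^ ((s + 1) * k%:Z)
        * (('C(n, k))%:R * ('C(2 * (2 * n - k), 2 * n - k))%:R
             * ('C(2 * n - k, n))%:R / ('C(2 * (n - k), n - k))%:R)
        * ((fib (r + s))%:~R / (fib r)%:~R) ^+ k * (fib (s * k%:Z + p))%:~R
    = ('C(2 * n, n))%:R * (\sum_(k < n.+1)
        (-1) ^ ((s + 1) * k%:Z)
        * (('C(n, k))%:R ^+ 2 / ('C(2 * (n - k), n - k))%:R)
        * 2 ^+ (2 * (n - k))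
        * ((fib s)%:~R / (fib r)%:~R) ^+ k * (fib ((r + s) * k%:Z + p))%:~R)
      :> R
    /\
    \sum_(k < n.+1)
        (-1) ^ ((s + 1) * k%:Z)
        * (('C(n, k))%:R * ('C(2 * (2 * n - k), 2 * n - k))%:R
             * ('C(2 * n - k, n))%:R / ('C(2 * (n - k), n - k))%:R)
        * ((fib (r + s))%:~R / (fib r)%:~R) ^+ k * (lucas (s * k%:Z + p))%:~R
    = ('C(2 * n, n))%:R * (\sum_(k < n.+1)
        (-1) ^ ((s + 1) * k%:Z)
        * (('C(n, k))%:R ^+ 2 / ('C(2 * (n - k), n - k))%:R)
        * 2 ^+ (2 * (n - k))
        * ((fib s)%:~R / (fib r)%:~R) ^+ k * (lucas ((r + s) * k%:Z + p))%:~R)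
      :> R).
Proof.
by split=> [m n|n]; split; first [exact: gibonacci_gbinom_sum
                                 | exact: gibonacci_bin_sum].
Qed.
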